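(* Let $F_m$ be the output of the PGA with shrinkage parameter $\nu\in(0,1]$ after $m\ge1$ iterations and let $R_m=Y-F_m$. Suppose $|X^{(k)}|_n=1$ for every $k\le K$. Then, for any $B>0$ and any $\mu\in\mathcal L(B)$, $$|R_m|_n^2\le|Y-\mu(X)|_n^2+\left(\frac{4|Y|_n^4B^2}{\nu(2-\nu)m}\right)^{1/3}.$$
   Context: Given data $(Y_i,X_i)$, $i=1,\dots,n$, with $Y_i\in\mathbb R$ and $X_i=(X_i^{(1)},\dots,X_i^{(K)})\in\mathbb R^K$, for functions $f,g$ of $(Y,X)$ put $\langle f,g\rangle_n=\frac1n\sum_{i=1}^nf(Y_i,X_i)g(Y_i,X_i)$ and $|f|_n^2=\langle f,f\rangle_n$. $\mathcal L(B)=\{\mu:\mu(X)=\sum_{k=1}^Kb_kX^{(k)},\ \sum_{k=1}^K|b_k|\le B\}$. PGA (Pure Greedy Algorithm, or $L_2$-Boosting): $F_0=0$ and for $j=1,\dots,m$: $s(j)=\arg\max_k|\langle Y-F_{j-1},X^{(k)}\rangle_n|$, $F_j=F_{j-1}+\nu\langle Y-F_{j-1},X^{(s(j))}\rangle_nX^{(s(j))}$. *)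

(* Defs.v *)
From mathcomp Require Import all_boot all_order all_algebra.
From mathcomp Require Import all_classical all_reals all_analysis.

Set Implicit Arguments.
Unset Strict Implicit.
Unset Printing Implicit Defensive.

Import Order.TTheory GRing.Theory Num.Theory.

Local Open Scope ring_scope.
Local Open Scope classical_set_scope.

Section EmpiricalL2.
Variables (R : realType) (K n : nat).

(* An observation z = (y, x) is a value of the pair (Y, X); a data set is     *)
(* a family of n such observations, D i = (Y_i, X_i).                         *)
Definition obs : Type := (R * 'rV[R]_K)%type.

Definition resp : obs -> R := fun z => z.1.

Definition covar (k : 'I_K) : obs -> R := fun z => z.2 0 k.

Definition emp_inner (D : 'I_n -> obs) (f g : obs -> R) : R :=
  n%:R^-1 * \sum_(i < n) f (D i) * g (D i).

Definition emp_norm (D : 'I_n -> obs) (f : obs -> R) : R :=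
  Num.sqrt (emp_inner D f f).

Definition residual (F : 'rV[R]_K -> R) : obs -> R :=
  fun z => resp z - F z.2.

Definition lin_class (B : R) : set ('rV[R]_K -> R) :=
  [set mu : 'rV[R]_K -> R | exists b : 'I_K -> R,
     (forall x : 'rV[R]_K, mu x = \sum_(k < K) b k * x 0 k) /\
     \sum_(k < K) `|b k| <= B].

Definition is_argmax (h : 'I_K -> R) (k0 : 'I_K) : Prop :=
  forall k, h k <= h k0.

(* F 0, ..., F m is a run of the Pure Greedy Algorithm with shrinkage nu in   *)
(* which s j is the coordinate selected at iteration j (1 <= j <= m).  Ties   *)
(* in the argmax may be broken in any way; the values of s and F outside      *)
(* these ranges are irrelevant.                                               *)
Definition PGA (D : 'I_n -> obs) (nu : R) (m : nat)
    (s : nat -> 'I_K) (F : nat -> 'rV[R]_K -> R) : Prop :=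
  (forall x, F 0%N x = 0) /\
  forall j, (1 <= j <= m)%N ->
    is_argmax (fun k => `|emp_inner D (residual (F j.-1)) (covar k)|) (s j) /\
    forall x : 'rV[R]_K, F j x = F j.-1 x
      + nu * emp_inner D (residual (F j.-1)) (covar (s j)) * x 0 (s j).

End EmpiricalL2.

Arguments resp {R K}.
Arguments covar {R K} k.

(* Main.v *)
(** Write [q_j = |R_j|^2], [g_j] for the maximal correlation at step [j+1] and
    [l_j = nu * (g_0 + ... + g_{j-1})], which bounds the l1-norm of the
    coefficients of [F_j].  A step lowers [q_j] by [(2 - nu) * s * g_j], where
    [s = nu * g_j], and [<R_j, h> <= g_j * x] for every [h] in [L(x)].

    The heart of the proof is that, for every [h] in [L(x)] and with
    [delta = l_m - l_j],
      [(2 x + (2 - nu) delta) q_m <= 2 x q_j + (2 - nu) delta |R_j - h|^2].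
    This is shown by backward induction on [j].  The comparator [F_j + h] is not
    kept fixed along the induction: before each step [h] is stretched by the
    factor [delta / (delta - s)].  With the fixed comparator [mu], the noise
    term [Y - mu] would lead to a worse power of [m].

    For [j = 0] and [h = mu] this bounds [A = q_m - |Y - mu|^2] by
    [2 B |Y|^2 / (2 B + (2 - nu) l_m)].  On the other hand
    [A <= 2 g_j (B + l_j)] for all [j], so that [(B + l_j)^2] grows by at least
    [nu A] at each step and [m nu A <= l_m (2 B + l_m)].  The two bounds give
    [A^3 <= 4 |Y|^4 B^2 / (nu (2 - nu) m)]. *)
Require Import Defs.
From mathcomp Require Import all_boot all_order all_algebra.
From mathcomp Require Import all_classical all_reals all_analysis.
From mathcomp Require Import ring lra zify.

Set Implicit Arguments.
Unset Strict Implicit.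
Unset Printing Implicit Defensive.

Import Order.TTheory GRing.Theory Num.Theory.

Local Open Scope ring_scope.
Local Open Scope classical_set_scope.

(** * Empirical inner product and l1-balls of linear functions *)

Section EmpiricalInner.
Variables (R : realType) (K n : nat) (D : 'I_n -> obs R K).
Implicit Types (f u v : obs R K -> R) (h : 'rV[R]_K -> R).

Lemma emp_innerC f u : emp_inner D f u = emp_inner D u f.
Proof. by congr (_ * _); apply: eq_bigr => i _; rewrite mulrC. Qed.

Lemma emp_inner_linear f a u b v :
  emp_inner D f (fun z => a * u z + b * v z) =
  a * emp_inner D f u + b * emp_inner D f v.
Proof.
rewrite /emp_inner 2!(mulrCA _ n%:R^-1) -mulrDr; congr (_ * _).
rewrite 2!mulr_sumr -big_split /=; apply: eq_bigr => i _; ring.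
Qed.

Lemma emp_inner_sqr a u b v :
  emp_inner D (fun z => a * u z + b * v z) (fun z => a * u z + b * v z) =
  a ^+ 2 * emp_inner D u u + 2 * a * b * emp_inner D u v
  + b ^+ 2 * emp_inner D v v.
Proof.
rewrite emp_inner_linear !(emp_innerC (fun z => a * u z + b * v z)).
rewrite !emp_inner_linear (emp_innerC v u); ring.
Qed.

Lemma emp_inner_ge0 f : 0 <= emp_inner D f f.
Proof.
by rewrite mulr_ge0 ?invr_ge0// sumr_ge0// => i _; rewrite -expr2 sqr_ge0.
Qed.

Lemma sqr_emp_norm f : emp_norm D f ^+ 2 = emp_inner D f f.
Proof. by rewrite sqr_sqrtr // emp_inner_ge0. Qed.

Lemma lin_class_le f h g x : lin_class x h ->
  (forall k, `|emp_inner D f (covar k)| <= g) -> 0 <= g ->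
  emp_inner D f (fun z => h z.2) <= g * x.
Proof.
move=> [b [hE bx]] fg g0; apply: le_trans (ler_wpM2l g0 bx).
have -> : emp_inner D f (fun z => h z.2) =
    \sum_k b k * emp_inner D f (covar k).
  under eq_bigr => k _ do rewrite /emp_inner mulrCA mulr_sumr.
  rewrite -mulr_sumr exchange_big /=; congr (_ * _); apply: eq_bigr => i _.
  by rewrite hE mulr_sumr; apply: eq_bigr => k _; rewrite mulrCA.
rewrite mulr_sumr; apply: ler_sum => k _.
by rewrite (le_trans (ler_norm _))// normrM mulrC ler_wpM2r.
Qed.

Lemma lin_class_add h x t c k : 0 <= t -> lin_class x h ->
  lin_class (t * x + `|c|) (fun w => t * h w + c * w 0 k).
Proof.
move=> t0 [b [hE bx]].
exists (fun i => t * b i + c * (i == k)%:R); split=> [w|].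
  rewrite hE mulr_sumr (bigD1 k)//= [RHS](bigD1 k)//= eqxx mulr1 addrAC.
  rewrite mulrDl mulrA; congr (_ + _); apply: eq_bigr => i /negPf ->.
  by rewrite mulr0 addr0 mulrA.
apply: (@le_trans _ _ (\sum_i (t * `|b i| + `|c| * (i == k)%:R))).
  apply: ler_sum => i _; apply: le_trans (ler_normD _ _) _.
  by rewrite !normrM (ger0_norm t0) normr_nat.
rewrite big_split /= -!mulr_sumr lerD ?ler_wpM2l//.
by rewrite (bigD1 k)//= eqxx big1 ?addr0 ?mulr1// => i /negPf ->.
Qed.

End EmpiricalInner.

(* Here [q], [q1], [qm] are the squared residual norms at the current, the next
   and the last step, [r = <R_j, h>] and [d = |h|^2]; the last hypothesis is the
   induction hypothesis for [h] stretched by [t]. *)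
Lemma stretch_step (R : realType) (q q1 qm r d g x s theta delta : R) :
  0 < x -> 0 <= d -> 0 <= g -> 0 <= s -> s <= delta -> 1 <= theta ->
  r <= g * x -> q1 = q - theta * s * g -> qm <= q1 ->
  (forall t, 1 <= t ->
     (2 * (t * x + s) + theta * (delta - s)) * qm <=
     2 * (t * x + s) * q1 + theta * (delta - s) * (q - 2 * t * r + t ^+ 2 * d)) ->
  (2 * x + theta * delta) * qm <=
  2 * x * q + theta * delta * (q - 2 * r + d).
Proof.
move=> x0 d_ge0 g0 s0 sd th1 rgx q1E qm1 IH.
have sg0 : 0 <= theta * s * g by rewrite !mulr_ge0//; lra.
have qmq : 0 <= q - qm by lra.
have thd0 : 0 <= theta * delta by rewrite mulr_ge0//; lra.
have [rd|dr] := leP (2 * r) d.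
  have : 0 <= (2 * x + theta * delta) * (q - qm) by rewrite mulr_ge0//; lra.
  have : 0 <= theta * delta * (d - 2 * r) by rewrite mulr_ge0//; lra.
  lra.
(* For [s = delta] no stretch factor exists; the decrease [theta * s * g] alone suffices, as
   [r <= g * x]. *)
move: sd; rewrite le_eqVlt => /predU1P[sd|sd].
  have : 0 <= (2 * x + theta * delta) * (q - theta * s * g - qm).
    by rewrite mulr_ge0//; lra.
  have : 0 <= theta * delta * (g * (2 * x + theta * delta) - (2 * r - d)).
    rewrite mulr_ge0//; have : 0 <= g * (theta * delta) by rewrite mulr_ge0.
    lra.
  rewrite sd; lra.
have d0 : 0 < delta by lra.
have u0 : 0 < delta - s by lra.
(* This factor makes the [d]-term of the hypothesis, times [delta - s], equal to that of the goal,
   times [delta]. *)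
have /IH : 1 <= delta / (delta - s) by rewrite ler_pdivlMr//; lra.
move=> /(ler_wpM2l (ltW u0)).
set t := delta / (delta - s).
have tu : t * (delta - s) = delta by rewrite divfK// gt_eqF.
set u := delta - s in tu u0 *; rewrite q1E => H.
have {}H : theta * delta ^+ 2 * (2 * r - d)
    <= (2 * x * delta + 2 * s * u + theta * u ^+ 2) * (q - qm).
  have e1 : u * ((2 * (t * x + s) + theta * u) * qm) =
     (2 * x * delta + 2 * s * u + theta * u ^+ 2) * qm by rewrite -tu; ring.
  have e2 : u * (2 * (t * x + s) * (q - theta * s * g) +
                theta * u * (q - 2 * t * r + t ^+ 2 * d)) =
     (2 * x * delta + 2 * s * u) * (q - theta * s * g)
     + theta * (u ^+ 2 * q - 2 * u * delta * r + delta ^+ 2 * d).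
    by rewrite -tu; ring.
  rewrite e1 e2 in H.
  (* The [r]-terms then differ by [2 * theta * delta * s * r], which the decrease of [q] covers. *)
  have : 0 <= 2 * delta * (theta * s) * (g * x - r).
    by rewrite !mulr_ge0//; lra.
  have : 0 <= 2 * s * u * (theta * s * g) by rewrite !mulr_ge0//; lra.
  rewrite /u in H *; lra.
(* Here [theta >= 1] enters, that is [nu <= 1]. *)
have Z : 2 * x * delta + 2 * s * u + theta * u ^+ 2 <=
    delta * (2 * x + theta * delta).
  have : 0 <= s * ((theta - 1) * (2 * delta - s) + s).
    by rewrite mulr_ge0// addr_ge0// mulr_ge0//; lra.
  rewrite /u; lra.
have {}H := le_trans H (ler_wpM2r qmq Z).
have : theta * delta * (2 * r - d) <= (2 * x + theta * delta) * (q - qm).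
  by rewrite -(ler_pM2l d0); lra.
lra.
Qed.

(** * Decrease of the residuals and the moving comparator *)

Section GreedyRun.
Variables (R : realType) (n K : nat) (D : 'I_n -> obs R K) (nu : R) (m : nat).
Variables (s : nat -> 'I_K) (F : nat -> 'rV[R]_K -> R).
Hypotheses (nu_gt0 : 0 < nu) (nu_le1 : nu <= 1) (F_PGA : PGA D nu m s F).
Hypothesis X_norm1 : forall k : 'I_K, emp_norm D (covar k) = 1.

Let sqn (f : obs R K -> R) := emp_inner D f f.
Let res j := residual (F j).
(** Signed, and indexed by the residual that iteration [j.+1] starts from; its absolute value is
    [g_j]. *)
Let gamma j := emp_inner D (res j) (covar (s j.+1)).
Let ell j := nu * \sum_(i < j) `|gamma i|.
Let diff j (h : 'rV[R]_K -> R) : obs R K -> R := fun z => res j z - h z.2.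

Lemma sqn_ge0 f : 0 <= sqn f.
Proof. exact: emp_inner_ge0. Qed.

Lemma theta_ge1 : 1 <= 2 - nu.
Proof. have := nu_le1; lra. Qed.

Lemma theta_ge0 : 0 <= 2 - nu.
Proof. exact: le_trans theta_ge1. Qed.

Lemma ellS j : ell j.+1 = ell j + nu * `|gamma j|.
Proof. by rewrite /ell big_ord_recr /= mulrDr. Qed.

Lemma ell_le i j : (i <= j)%N -> ell i <= ell j.
Proof.
move=> /subnK <-; elim: (j - i)%N => // k IH.
by rewrite addSn ellS (le_trans IH)// lerDl mulr_ge0// ltW.
Qed.

Lemma ell_ge0 j : 0 <= ell j.
Proof. by rewrite mulr_ge0 ?sumr_ge0// ltW. Qed.

Lemma covar_sqn k : sqn (covar k) = 1.
Proof. by rewrite /sqn -sqr_emp_norm X_norm1 expr1n. Qed.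

Lemma gamma_max j k : (j < m)%N ->
  `|emp_inner D (res j) (covar k)| <= `|gamma j|.
Proof. by move=> jm; have [_ /(_ j.+1 jm)[+ _]] := F_PGA; exact. Qed.

Lemma resS j : (j < m)%N ->
  res j.+1 = fun z => 1 * res j z + - (nu * gamma j) * covar (s j.+1) z.
Proof.
move=> jm; have [_ /(_ j.+1 jm)[_ /= FS]] := F_PGA.
by apply: funext => z; rewrite /res /residual FS /gamma /res /covar; ring.
Qed.

Lemma sqn_resS j : (j < m)%N ->
  sqn (res j.+1) = sqn (res j) - (2 - nu) * (nu * `|gamma j|) * `|gamma j|.
Proof.
move=> jm; rewrite /sqn resS// emp_inner_sqr.
have := covar_sqn (s j.+1); rewrite /sqn => ->; rewrite -/(gamma j).
have := real_normK (num_real (gamma j)) => ng.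
rewrite -!mulrA -expr2 ng; ring.
Qed.

Lemma sqn_res_le i j : (i <= j <= m)%N -> sqn (res j) <= sqn (res i).
Proof.
move=> /andP[/subnK <-]; elim: (j - i)%N => // k IH km.
apply: le_trans (IH (ltnW km)); rewrite sqn_resS// gerBl.
by rewrite !mulr_ge0 ?theta_ge0// ltW.
Qed.

Lemma sqn_diff j h : sqn (diff j h) =
  sqn (res j) - 2 * emp_inner D (res j) (fun z => h z.2)
  + sqn (fun z => h z.2).
Proof.
have -> : diff j h = fun z => 1 * res j z + (-1) * h z.2.
  by apply: funext => z; rewrite /diff; ring.
rewrite /sqn emp_inner_sqr; ring.
Qed.

Lemma res_comparator j (x : R) h : (j <= m)%N -> 0 < x -> lin_class x h ->
  (2 * x + (2 - nu) * (ell m - ell j)) * sqn (res m) <=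
  2 * x * sqn (res j) + (2 - nu) * (ell m - ell j) * sqn (diff j h).
Proof.
move=> /subKn; move: (m - j)%N => k.
elim: k j x h => [|k IH] j x h.
  by rewrite subn0 => <- _ _; rewrite subrr !mulr0 mul0r !addr0.
move=> jE x0 hx.
(* Subtraction is truncated: for [m <= k] both [m - k] and [m - k.+1] are zero, so [j] does not
   change. *)
have [km|mk] := ltnP k m; last first.
  have jE' : (m - k)%N = j by lia.
  exact: IH.
have jm : (j < m)%N by rewrite -jE; lia.
have jE' : (m - k)%N = j.+1 by rewrite -jE; lia.
set g := `|gamma j|.
rewrite sqn_diff.
apply: (@stretch_step R (sqn (res j)) (sqn (res j.+1)) _ _ _ g x (nu * g)).
- by [].
- exact: sqn_ge0.
- exact: normr_ge0.
- by rewrite mulr_ge0 ?normr_ge0// ltW.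
- by rewrite lerBrDl -ellS ell_le.
- exact: theta_ge1.
- exact: lin_class_le hx (fun k' => gamma_max k' jm) (normr_ge0 _).
- exact: sqn_resS.
- by apply: sqn_res_le; rewrite jm leqnn.
move=> t t1.
(* With this choice [F j.+1 + h'] equals [F j + t * h]: the step just made is taken back, at l1-cost
   [nu * g]. *)
pose h' v := t * h v + - (nu * gamma j) * v 0 (s j.+1).
have h'x : lin_class (t * x + nu * g) h'.
  have -> : nu * g = `|- (nu * gamma j)| by rewrite normrN normrM gtr0_norm.
  by apply: lin_class_add => //; lra.
have x'0 : 0 < t * x + nu * g.
  have : 0 < t * x by rewrite mulr_gt0//; lra.
  have : 0 <= nu * g by rewrite mulr_ge0 ?normr_ge0// ltW.
  lra.
have := IH _ _ _ jE' x'0 h'x.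
have -> : diff j.+1 h' = fun z => 1 * res j z + - t * h z.2.
  by apply: funext => z; rewrite /diff resS// /h' /covar; ring.
rewrite /sqn emp_inner_sqr -/(sqn _) ellS -/g opprD addrA.
by congr (_ <= _ + _ * _); ring.
Qed.

(** * Growth of [ell] and the final bound *)

Lemma lin_class_subF j (B : R) mu : (j <= m)%N -> lin_class B mu ->
  lin_class (B + ell j) (fun v => mu v - F j v).
Proof.
have [F0 FS] := F_PGA => + muB; elim: j => [_|j IH jm].
  rewrite /ell big_ord0 mulr0 addr0.
  by congr (lin_class _ _): muB; apply: funext => v; rewrite F0 subr0.
have := lin_class_add (- (nu * gamma j)) (s j.+1) ler01 (IH (ltnW jm)).
rewrite mul1r normrN normrM gtr0_norm// -addrA -ellS.
congr (lin_class _ _); apply: funext => v.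
by have [_ ->] := FS j.+1 jm; rewrite /gamma /res /=; ring.
Qed.

(** Expand [|Y - mu|^2] around [res j] with [h = mu - F j], and drop [|h|^2]. *)
Lemma excess_le j (B : R) mu : (j < m)%N -> lin_class B mu ->
  sqn (res m) - sqn (residual mu) <= 2 * `|gamma j| * (B + ell j).
Proof.
move=> jm muB.
have := @lin_class_le _ _ _ D (res j) _ `|gamma j| _
  (lin_class_subF (ltnW jm) muB) (fun k => gamma_max k jm) (normr_ge0 _).
set h := fun v => mu v - F j v => rh.
have := sqn_diff j h.
have -> : diff j h = residual mu.
  by apply: funext => z; rewrite /diff /res /h /residual; ring.
have := sqn_ge0 (fun z => h z.2).
have := @sqn_res_le j m; rewrite ltnW ?leqnn// => /(_ isT).
lra.
Qed.

(** Telescoping: the right side is [(B + ell j)^2 - B^2], and a step adds at least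
    [2 * nu * |gamma j| * (B + ell j)] to it. *)
Lemma ell_growth j (B : R) mu : (j <= m)%N -> 0 < B -> lin_class B mu ->
  j%:R * nu * (sqn (res m) - sqn (residual mu)) <= ell j * (2 * B + ell j).
Proof.
move=> + B0 muB; elim: j => [_|j IH jm].
  by rewrite /ell big_ord0 mulr0 !mul0r.
have := ler_wpM2l (ltW nu_gt0) (excess_le jm muB).
have := IH (ltnW jm); rewrite ellS -natr1.
have := sqr_ge0 (nu * `|gamma j|); lra.
Qed.

Lemma excess_cube (B : R) mu : 0 < B -> lin_class B mu ->
  let A := sqn (res m) - sqn (residual mu) in
  0 <= A -> nu * (2 - nu) * m%:R * A ^+ 3 <= 4 * sqn resp ^+ 2 * B ^+ 2.
Proof.
move=> B0 muB A A0.
have := res_comparator (leq0n m) B0 muB.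
have r0 : res 0%N = resp.
  by apply: funext => z; rewrite /res /residual F_PGA.1 subr0.
have -> : diff 0%N mu = residual mu.
  by apply: funext => z; rewrite /diff r0.
rewrite r0 /ell big_ord0 mulr0 subr0 -/(ell m); set L := ell m => HB.
have L0 : 0 <= L := ell_ge0 m.
have HL := ell_growth (leqnn m) B0 muB; rewrite -/L -/A in HL.
have th0 : 0 <= (2 - nu) * L by rewrite mulr_ge0 ?theta_ge0.
have Blin : (2 * B + (2 - nu) * L) * A <= 2 * B * sqn resp.
  have : 0 <= 2 * B * sqn (residual mu).
    by rewrite mulr_ge0 ?sqn_ge0// mulr_ge0// ltW.
  rewrite /A; lra.
have Bsqr : (2 * B + (2 - nu) * L) ^+ 2 * A ^+ 2 <= 4 * sqn resp ^+ 2 * B ^+ 2.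
  have -> : 4 * sqn resp ^+ 2 * B ^+ 2 = (2 * B * sqn resp) ^+ 2 by ring.
  rewrite -exprMn; apply: lerXn2r => //; rewrite nnegrE.
    by rewrite mulr_ge0//; lra.
  by rewrite mulr_ge0 ?sqn_ge0// mulr_ge0// ltW.
apply: le_trans Bsqr.
(* One factor [A] is bounded by the growth of [ell]; the other two stand in [Bsqr]. *)
have -> : nu * (2 - nu) * m%:R * A ^+ 3 = (2 - nu) * (m%:R * nu * A) * A ^+ 2.
  ring.
apply: ler_wpM2r; first exact: sqr_ge0.
apply: (@le_trans _ _ ((2 - nu) * (L * (2 * B + L)))).
  exact: ler_wpM2l theta_ge0 _ _ HL.
(* With [c = 2 - nu], the slack is [4 B^2 + 2 B c L + c (1 - nu) L^2]. *)
have : 0 <= (2 - nu) * (1 - nu) * L ^+ 2.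
  by rewrite mulr_ge0 ?sqr_ge0// mulr_ge0 ?theta_ge0 ?subr_ge0.
have : 0 <= B * ((2 - nu) * L) by rewrite mulr_ge0// ltW.
have := sqr_ge0 B; lra.
Qed.

End GreedyRun.

Theorem lemma4 (R : realType) (n K : nat) (D : 'I_n -> obs R K)
    (nu : R) (m : nat) (s : nat -> 'I_K) (F : nat -> 'rV[R]_K -> R)
    (n_gt0 : (0 < n)%N) (nu_gt0 : 0 < nu) (nu_le1 : nu <= 1)
    (m_ge1 : (1 <= m)%N) (F_PGA : PGA D nu m s F)
    (X_norm1 : forall k : 'I_K, emp_norm D (covar k) = 1)
    (B : R) (B_gt0 : 0 < B)
    (mu : 'rV[R]_K -> R) (mu_LB : lin_class B mu) :
  emp_norm D (residual (F m)) ^+ 2 <=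
    emp_norm D (residual mu) ^+ 2
    + ((4 * emp_norm D resp ^+ 4 * B ^+ 2) / (nu * (2 - nu) * m%:R))
        `^ (3%:R^-1).
Proof.
rewrite (exprM _ 2 2) !sqr_emp_norm -lerBlDl.
have := excess_cube nu_gt0 nu_le1 F_PGA X_norm1 B_gt0 mu_LB.
set A := _ - _ => /= HA.
(* A negative excess is harmless, since real powers are nonnegative. *)
have [A0|A0] := leP 0 A; last by rewrite (le_trans (ltW A0))// powR_ge0.
have c0 : 0 < nu * (2 - nu) * m%:R.
  by rewrite !mulr_gt0 ?ltr0n//; lra.
have -> : A = (A ^+ 3) `^ 3%:R^-1.
  by rewrite -powR_mulrn// -powRrM mulfV ?pnatr_eq0// powRr1.
apply: ge0_ler_powR; rewrite ?nnegrE ?invr_ge0 ?exprn_ge0//.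
  by rewrite divr_ge0 ?(ltW c0)// mulr_ge0 ?sqr_ge0// mulr_ge0 ?sqr_ge0.
by rewrite ler_pdivlMr// mulrC; exact: HA.
Qed.
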